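(* Let $\mathcal{A}\in\mathbb{C}^{\mathbf{I}(N)\times\mathbf{I}(N)}$ be nonsingular, $\mathcal{B}\in\mathbb{C}^{\mathbf{I}(N)}$, let $\mathcal{H}\in\mathbb{C}^{\mathbf{I}(N)\times\mathbf{I}(N)}$ be the iteration tensor and $\mathcal{C}=(\mathcal{I}-\mathcal{H})*_N\mathcal{A}^{-1}*_N\mathcal{B}$. Then the iterative scheme $$\mathcal{X}^{(k+1)}=\mathcal{H}*_N\mathcal{X}^{(k)}+\mathcal{C},\qquad k=0,1,2,\dots$$ converges to $\mathcal{A}^{-1}*_N\mathcal{B}$ for every initial guess $\mathcal{X}^{(0)}\in\mathbb{C}^{\mathbf{I}(N)}$ if and only if $\rho(\mathcal{H})<1$.
   Context: For positive integers $I_1,\dots,I_N$ write $\mathbf{I}(N)=I_1\times\cdots\times I_N$; $\mathbb{C}^{\mathbf{I}(N)\times\mathbf{J}(N)}$ is the set of complex tensors with entries $a_{i_1\dots i_N j_1\dots j_N}$, $1\le i_s\le I_s$, $1\le j_s\le J_s$. The Einstein product of $\mathcal{A}\in\mathbb{C}^{\mathbf{I}(N)\times\mathbf{K}(N)}$ and $\mathcal{B}\in\mathbb{C}^{\mathbf{K}(N)\times\mathbf{J}(N)}$ is $(\mathcal{A}*_N\mathcal{B})_{i_1\dots i_N j_1\dots j_N}=\sum_{k_1,\dots,k_N}a_{i_1\dots i_N k_1\dots k_N}b_{k_1\dots k_N j_1\dots j_N}$; for $\mathcal{X}\in\mathbb{C}^{\mathbf{K}(N)}$, $(\mathcal{A}*_N\mathcal{X})_{i_1\dots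 i_N}=\sum_{k_1,\dots,k_N}a_{i_1\dots i_N k_1\dots k_N}x_{k_1\dots k_N}$. $\mathcal{I}$ is the identity tensor and $\mathcal{A}^{-1}$ the inverse with respect to $*_N$. A number $\lambda\in\mathbb{C}$ is an eigenvalue of $\mathcal{H}\in\mathbb{C}^{\mathbf{I}(N)\times\mathbf{I}(N)}$ if $\mathcal{H}*_N\mathcal{X}=\lambda\mathcal{X}$ for some nonzero $\mathcal{X}\in\mathbb{C}^{\mathbf{I}(N)}$; the spectral radius $\rho(\mathcal{H})$ is the largest absolute value of the eigenvalues of $\mathcal{H}$. Convergence is entrywise. *)

(* Defs.v *)
From HB Require Import structures.
From mathcomp Require Import all_boot all_order all_algebra.
From mathcomp Require Import all_classical all_reals all_analysis.
From mathcomp Require Export complex.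

Set Implicit Arguments.
Unset Strict Implicit.
Unset Printing Implicit Defensive.

Import Order.TTheory GRing.Theory Num.Theory.
Import numFieldNormedType.Exports.
Import ComplexField.Normc.

Local Open Scope classical_set_scope.
Local Open Scope ring_scope.

(* The dimensions of a tensor are given by a function [I : 'I_N -> nat];
   indices are 0-based, i_s ranging over {0, ..., I s - 1}. *)
Definition midx (N : nat) (I : 'I_N -> nat) : finType :=
  {dffun forall s : 'I_N, 'I_(I s)}.

Definition tensor (R : realType) (N : nat) (I : 'I_N -> nat) :=
  {ffun midx I -> R[i]}.

(* C^{I(N) x J(N)}: the order-2N tensors, whose 2N indices are grouped into
   two blocks of N. *)
Definition tensor2 (R : realType) (N : nat) (I J : 'I_N -> nat) :=
  {ffun midx I * midx J -> R[i]}.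

Section EinsteinProduct.
Variables (R : realType) (N : nat).
Implicit Types I J K : 'I_N -> nat.

Definition tmul I K J (A : tensor2 R I K) (B : tensor2 R K J) :
    tensor2 R I J :=
  [ffun p => \sum_(k : midx K) A (p.1, k) * B (k, p.2)].

Definition tapp I K (A : tensor2 R I K) (X : tensor R K) : tensor R I :=
  [ffun i => \sum_(k : midx K) A (i, k) * X k].

Definition tid I : tensor2 R I I := [ffun p => (p.1 == p.2)%:R].

Definition is_tinv I (A B : tensor2 R I I) : Prop :=
  tmul A B = tid I /\ tmul B A = tid I.

Definition tnonsingular I (A : tensor2 R I I) : Prop :=
  exists B : tensor2 R I I, is_tinv A B.

(* Equal to 0 when A is singular. *)
Definition tinv I (A : tensor2 R I I) : tensor2 R I I :=
  xget 0 [set B | is_tinv A B].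

Definition teigenvalue I (H : tensor2 R I I) (l : R[i]) : Prop :=
  exists X : tensor R I, X != 0 /\ tapp H X = [ffun i => l * X i].

(* A maximum whenever all dimensions are positive, see
   [spectral_radius_max]. *)
Definition spectral_radius I (H : tensor2 R I I) : R :=
  sup [set normc l | l in teigenvalue H].

(* [R[i]^o] is [R[i]] seen as a normed module over itself, hence with the
   topology of the complex modulus. *)
Definition tcvg I (X : nat -> tensor R I) (L : tensor R I) : Prop :=
  forall i : midx I, (fun k => X k i : R[i]^o) @ \oo --> (L i : R[i]^o).

Definition scheme I (H : tensor2 R I I) (C X0 : tensor R I) (k : nat) :
    tensor R I :=
  iter k (fun X => tapp H X + C) X0.

End EinsteinProduct.

Arguments tid {R N} I.

Section Facts.
Variables (R : realType) (N : nat) (I : 'I_N -> nat).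
Implicit Types A B C H : tensor2 R I I.

Lemma is_tinv_unique A B C : is_tinv A B -> is_tinv A C -> B = C.
Proof.
have mulA (X Y Z : tensor2 R I I) : tmul X (tmul Y Z) = tmul (tmul X Y) Z.
  apply/ffunP => p; rewrite !ffunE.
  under eq_bigr do rewrite ffunE big_distrr /=.
  rewrite exchange_big /=; apply: eq_bigr => k _.
  by rewrite ffunE big_distrl; apply: eq_bigr => j _; rewrite mulrA.
have mul1 (X : tensor2 R I I) : tmul (tid I) X = X.
  apply/ffunP => -[i j]; rewrite ffunE (bigD1 i) //= big1.
    by rewrite ffunE eqxx mul1r addr0.
  by move=> k kNi; rewrite ffunE /= eq_sym (negbTE kNi) mul0r.
have mulI (X : tensor2 R I I) : tmul X (tid I) = X.
  apply/ffunP => -[i j]; rewrite ffunE (bigD1 j) //= big1.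
    by rewrite ffunE eqxx mulr1 addr0.
  by move=> k kNj; rewrite ffunE /= (negbTE kNj) mulr0.
move=> [AB BA] [AC CA].
by rewrite -(mulI B) -AC mulA BA mul1.
Qed.

Lemma tinvP A : tnonsingular A -> is_tinv A (tinv A).
Proof. by move=> [B AB]; apply: (@xgetPex _ 0 [set B | is_tinv A B]); exists B. Qed.

Let n := #|midx I|.

(* Transposed since [eigenvalue] is about row vectors. *)
Definition mx_of_tensor2 H : 'M[R[i]]_n :=
  \matrix_(j, i) H (enum_val i, enum_val j).

Lemma teigenvalueE H (l : R[i]) :
  teigenvalue H l <-> eigenvalue (mx_of_tensor2 H) l.
Proof.
have rbij := onW_bij xpredT (@enum_val_bij (midx I)).
split=> [[X [X0 HX]]|/eigenvalueP[v vH v0]].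
- apply/eigenvalueP; exists (\row_i X (enum_val i)).
    apply/rowP => i; rewrite !mxE.
    have /ffunP/(_ (enum_val i)) := HX; rewrite !ffunE => <-.
    rewrite (reindex _ rbij) /=; apply: eq_bigr => j _.
    by rewrite !mxE mulrC.
  apply: contra X0 => /eqP/rowP X0; apply/eqP/ffunP => i.
  by have := X0 (enum_rank i); rewrite !mxE enum_rankK ffunE.
- exists [ffun i => v 0 (enum_rank i)]; split.
    apply: contra v0 => /eqP/ffunP v0; apply/eqP/rowP => i.
    by have := v0 (enum_val i); rewrite !ffunE enum_valK mxE.
  apply/ffunP => i; rewrite !ffunE.
  have /rowP/(_ (enum_rank i)) := vH; rewrite !mxE => <-.
  rewrite (reindex _ rbij) /=; apply: eq_bigr => j _.
  by rewrite ffunE !mxE enum_valK enum_rankK mulrC.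
Qed.

Lemma spectral_radius_max H : (forall s, 0 < I s)%N ->
  (exists2 l, teigenvalue H l & normc l = spectral_radius H) /\
  (forall l, teigenvalue H l -> normc l <= spectral_radius H).
Proof.
move=> I0; pose M := mx_of_tensor2 H.
have n0 : (0 < n)%N.
  by apply/card_gt0P; exists (finfun (fun s => Ordinal (I0 s))).
have [l0 l0M] : exists l, eigenvalue M l.
  have [|l] := @closed_rootP _ (char_poly M) _.
    by rewrite size_char_poly; case: (n) n0.
  by rewrite -eigenvalue_root_char; exists l.
have [s sM] : exists s : seq R[i], char_poly M = \prod_(z <- s) ('X - z%:P).
  have [s ->] := closed_field_poly_normal (char_poly M).
  by rewrite (monicP (char_poly_monic _)) scale1r; exists s.
have sE l : eigenvalue M l = (l \in s).
  by rewrite eigenvalue_root_char sM root_prod_XsubC.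
pose m : R := \big[Num.max/normc l0]_(l <- s) normc l.
have ms l : l \in s -> normc l <= m.
  by move=> ls; exact: le_bigmax_seq.
have [l1 l1s ml1] : exists2 l1, l1 \in s & normc l1 = m.
  rewrite /m; have : l0 \in s by rewrite -sE.
  move: (l0) => z zs; rewrite big_seq.
  elim/big_ind: _ => [|_ _ [a a_s <-] [b b_s <-]|a a_s]; first by exists z.
    by rewrite /Num.max; case: ifP => _; [exists b|exists a].
  by exists a.
have mE : spectral_radius H = m.
  apply/eqP; rewrite eq_le; apply/andP; split.
    apply: ge_sup; first by exists m, l1; rewrite // teigenvalueE sE.
    by move=> _ [l /teigenvalueE lH <-]; apply: ms; rewrite -sE.
  apply: ub_le_sup; last by exists l1; rewrite // teigenvalueE sE.
  by exists m => _ [l /teigenvalueE lH <-]; apply: ms; rewrite -sE.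
split; last by move=> l /teigenvalueE; rewrite sE mE; exact: ms.
by exists l1; rewrite ?mE // teigenvalueE sE.
Qed.

End Facts.

(* Main.v *)
(** Since C = L - H L for L = A^-1 B, the error X_k - L is H^k applied to
    X_0 - L.  If every initial guess converges, an eigenvector X for l as initial
    error gives l^k X -> 0, hence |l| < 1.  Conversely, by Cayley-Hamilton the
    product of the factors H - z, z ranging over the eigenvalues, vanishes; the
    factors are removed one by one, because u_(k+1) - z u_k -> 0 and |z| < 1
    imply u_k -> 0. *)
Require Import Defs.
From mathcomp Require Import all_boot all_order all_algebra.
From mathcomp Require Import all_classical all_reals all_analysis.
From mathcomp Require Import lra.

Set Implicit Arguments.
Unset Strict Implicit.
Unset Printing Implicit Defensive.

Import Order.TTheory GRing.Theory Num.Theory.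
Import numFieldNormedType.Exports.
Import ComplexField.Normc.

Local Open Scope classical_set_scope.
Local Open Scope ring_scope.

Section ComplexSequences.
Variable R : realType.
Implicit Types (u : nat -> R[i]) (l z : R[i]).

Lemma normc_ge0 z : 0 <= normc z.
Proof. by case: z => a b; exact: sqrtr_ge0. Qed.

Lemma cvg_normcP u l :
  (u : nat -> R[i]^o) @ \oo --> (l : R[i]^o) <->
  (fun k => normc (u k - l)) @ \oo --> (0 : R).
Proof.
have normE k : `|(l : R[i]^o) - u k| = (normc (u k - l))%:C%C.
  by rewrite -normrN opprB.
split=> [/cvgrPdist_lt ul|/cvgrPdist_lt ul].
- apply/cvgrPdist_lt => e e0.
  have := ul e%:C%C; rewrite ltcR => /(_ e0).
  apply: filterS => k; rewrite sub0r normrN (ger0_norm (normc_ge0 _)).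
  by move=> ?; rewrite -ltcR -normE.
(* The tolerance is itself a complex number; being positive in the order on [R[i]], it has imaginary
   part 0. *)
- apply/cvgrPdist_lt => -[e e'] /=; rewrite ltcE /= => /andP[/eqP -> e0].
  have := ul e e0; apply: filterS => k.
  rewrite sub0r normrN (ger0_norm (normc_ge0 _)) => ue.
  by rewrite -ltcR -normE in ue.
Qed.

(** Once b stays below (1 - q) e/2, iterating the inequality from a rank m bounds a_(k+m) by q^k a_m
    + e/2, and the first term tends to 0. *)
Lemma cvg0_contraction (a b : R^nat) (q : R) :
  0 <= q < 1 -> (forall k, 0 <= a k) -> (forall k, a k.+1 <= q * a k + b k) ->
  b @ \oo --> (0 : R) -> a @ \oo --> (0 : R).
Proof.
move=> /andP[q0 q1] a0 ab /cvgrPdist_lt b0; apply/cvgrPdist_lt => e e0.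
(* This bound makes e/2 the fixed point of t |-> q t + (1 - q) e/2, so the term e/2 reproduces
   itself in the induction for [aq]. *)
have d0 : 0 < (1 - q) * (e / 2) by rewrite mulr_gt0 ?subr_gt0 ?divr_gt0.
have [m _ bm] := b0 _ d0.
have aq k : a (k + m)%N <= q ^+ k * a m + e / 2.
  elim: k => [|k IH]; first by rewrite add0n expr0 mul1r lerDl divr_ge0 // ltW.
  have : b (k + m)%N <= (1 - q) * (e / 2).
    have /= := bm (k + m)%N (leq_addl _ _); rewrite sub0r normrN => /ltW.
    exact: le_trans (ler_norm _).
  have := ler_wpM2l q0 IH; have := ab (k + m)%N.
  by rewrite addSn exprS; lra.
have : (fun k => q ^+ k * a m) @ \oo --> (0 : R).
  rewrite -[X in _ --> X](mul0r (a m)); apply: cvgM; last exact: cvg_cst.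
  by apply: cvg_expr; rewrite ger0_norm.
move=> /cvgrPdist_lt/(_ (e / 2)); rewrite divr_gt0// => /(_ erefl)[p _ qp].
exists (p + m)%N => // k /= pmk.
have mk : (m <= k)%N by apply: leq_trans pmk; exact: leq_addl.
rewrite sub0r normrN ger0_norm // -(subnK mk).
apply: le_lt_trans (aq _) _.
have pkm : (p <= k - m)%N by rewrite leq_subRL // addnC.
have /= := qp _ pkm; rewrite sub0r normrN => /(le_lt_trans (ler_norm _)); lra.
Qed.

Lemma cvg0_recurrence u z : normc z < 1 ->
  (fun k => normc (u k.+1 - z * u k)) @ \oo --> (0 : R) ->
  (fun k => normc (u k)) @ \oo --> (0 : R).
Proof.
move=> z1; apply: (@cvg0_contraction _ _ (normc z)) => [|k|k].
- by rewrite normc_ge0.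
- exact: normc_ge0.
- rewrite -normcM addrC -[X in normc X <= _](subrK (z * u k)).
  exact: le_normcD.
Qed.

End ComplexSequences.

Section MatrixPowers.
Variable R : realType.

(** The matrix [Q] makes the induction on [s] work: it absorbs the first factor M - z. For u_k = (Q
    M^k)_ij, the induction hypothesis at Q (M - z) says exactly that u_(k+1) - z u_k tends to 0. *)
Lemma cvg0_expmx_factors n (M Q : 'M[R[i]]_n.+1) (s : seq R[i]) i j :
  (forall z, z \in s -> normc z < 1) -> Q * \prod_(z <- s) (M - z%:M) = 0 ->
  (fun k => normc ((Q * M ^+ k) i j)) @ \oo --> (0 : R).
Proof.
elim: s Q => [|z s IH] Q s1.
  rewrite big_nil mulr1 => ->; under eq_fun do rewrite mul0r mxE normc0.
  exact: cvg_cst.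
rewrite big_cons mulrA => Q0.
apply: (@cvg0_recurrence _ _ z); first exact/s1/mem_head.
have tail1 z' : z' \in s -> normc z' < 1.
  by move=> z's; apply: s1; rewrite inE z's orbT.
have factorE k : (Q * (M - z%:M) * M ^+ k) i j =
    (Q * M ^+ k.+1) i j - z * (Q * M ^+ k) i j.
  rewrite mulrBr mulrBl -mulrA -exprS -[_ * z%:M]/(Q *m z%:M).
  by rewrite scalar_mxC mul_scalar_mx -scalerAl !mxE.
by have := IH _ tail1 Q0; under eq_fun do rewrite factorE.
Qed.

Lemma cvg0_mulmx_iter n (M : 'M[R[i]]_n) (v : 'rV_n) j :
  (forall l, eigenvalue M l -> normc l < 1) ->
  (fun k => normc (iter k (mulmx^~ M) v 0 j)) @ \oo --> (0 : R).
Proof.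
(* Size 0 has no index [j]; a successor size is what the lemma on factors expects. *)
case: n M v j => [|n] M v j M1; first by case: j.
have [s sM] : exists s : seq R[i], char_poly M = \prod_(z <- s) ('X - z%:P).
  have [s ->] := closed_field_poly_normal (char_poly M).
  by rewrite (monicP (char_poly_monic _)) scale1r; exists s.
have s1 z : z \in s -> normc z < 1.
  by move=> zs; apply: M1; rewrite eigenvalue_root_char sM root_prod_XsubC.
have Ms : 1 * \prod_(z <- s) (M - z%:M) = 0.
  rewrite mul1r -(Cayley_Hamilton M) sM rmorph_prod; apply: eq_bigr => z _.
  by rewrite rmorphB /= horner_mx_X horner_mx_C.
have iterE k : iter k (mulmx^~ M) v = v *m M ^+ k.
  elim: k => [|k IH]; first by rewrite expr0 mulmx1.
  by rewrite iterS IH exprSr mulmxA.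
have Mk i : (fun k => normc (v 0 i * (M ^+ k) i j)) @ \oo --> (0 : R).
  under eq_fun do rewrite normcM.
  rewrite -(mulr0 (normc (v 0 i))); apply: cvgM; first exact: cvg_cst.
  have := cvg0_expmx_factors i j s1 Ms.
  by under eq_fun do rewrite mul1r.
have sum0 : (fun k => \sum_i normc (v 0 i * (M ^+ k) i j)) @ \oo --> (0 : R).
  have sum00 : \sum_(i < n.+1) (0 : R) = 0 by rewrite big1.
  rewrite -[X in _ --> X]sum00.
  by apply: cvg_big; [exact: add_continuous|move=> i _; exact: Mk].
(* By the triangle inequality, an entry of v M^k is bounded by the sum of the moduli in [sum0]. *)
apply: squeeze_cvgr (cvg_cst 0) sum0; apply: nearW => k.
rewrite normc_ge0 iterE mxE /=.
elim/big_ind2: _ => [|x a y b xa yb|//]; first by rewrite normc0.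
exact: le_trans (le_normcD _ _) (lerD xa yb).
Qed.

End MatrixPowers.

Section Scheme.
Variables (R : realType) (N : nat) (I : 'I_N -> nat).
Implicit Types (A H : tensor2 R I I) (X C L : tensor R I).

Lemma tappB H X C : tapp H (X - C) = tapp H X - tapp H C.
Proof.
apply/ffunP => i; rewrite !ffunE -sumrB; apply: eq_bigr => k _.
by rewrite !ffunE mulrBr.
Qed.

Lemma tapp_tmul A H X : tapp (tmul A H) X = tapp A (tapp H X).
Proof.
apply/ffunP => i; rewrite !ffunE.
under eq_bigr do rewrite ffunE big_distrl /=.
rewrite exchange_big /=; apply: eq_bigr => k _.
by rewrite ffunE big_distrr /=; apply: eq_bigr => j _; rewrite mulrA.
Qed.

Lemma tapp_tidB H X : tapp (tid I - H) X = X - tapp H X.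
Proof.
apply/ffunP => i; rewrite !ffunE.
under eq_bigr do rewrite !ffunE mulrBl.
rewrite sumrB (bigD1 i) //= eqxx mul1r big1 ?addr0 // => k.
by rewrite eq_sym => /negbTE ->; rewrite mul0r.
Qed.

Lemma scheme_error H L X k :
  scheme H (L - tapp H L) X k - L = iter k (tapp H) (X - L).
Proof.
elim: k => // k IH; rewrite [RHS]iterS -IH tappB /scheme iterS.
by rewrite addrA addrAC addrK addrC.
Qed.

(** Since [mx_of_tensor2] transposes, applying [H] to a tensor becomes right multiplication of its
    flattened row vector. *)
Lemma iter_tapp_mx H X k i :
  iter k (tapp H) X i =
  iter k (mulmx^~ (mx_of_tensor2 H)) (\row_j X (enum_val j)) 0 (enum_rank i).
Proof.
elim: k i => [|k IH] i; first by rewrite mxE enum_rankK.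
rewrite !iterS ffunE mxE (reindex _ (onW_bij xpredT (@enum_val_bij (midx I)))).
by apply: eq_bigr => j _; rewrite IH mxE enum_valK enum_rankK mulrC.
Qed.

Lemma tcvg_scheme H L X :
  tcvg (scheme H (L - tapp H L) X) L <->
  forall i, (fun k => normc (iter k (tapp H) (X - L) i)) @ \oo --> (0 : R).
Proof.
have eqE i : (fun k => normc (scheme H (L - tapp H L) X k i - L i)) =
             (fun k => normc (iter k (tapp H) (X - L) i)).
  by apply/funext => k; rewrite -scheme_error !ffunE.
split=> cv i; first by rewrite -eqE; exact/cvg_normcP/cv.
by apply/cvg_normcP; rewrite eqE.
Qed.

Lemma iter_tapp_eigen H X l k : tapp H X = [ffun i => l * X i] ->
  iter k (tapp H) X = [ffun i => l ^+ k * X i].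
Proof.
move=> HX; elim: k => [|k IH]; first by apply/ffunP => i; rewrite ffunE mul1r.
apply/ffunP => i; rewrite iterS IH !ffunE exprSr -mulrA.
have /ffunP/(_ i) := HX; rewrite !ffunE => <-; rewrite mulr_sumr.
by apply: eq_bigr => j _; rewrite ffunE mulrCA.
Qed.

(** If |l| >= 1, then |l^k X_i| >= |X_i| > 0 at any nonzero entry of an eigenvector X, which
    contradicts convergence to 0. *)
Lemma cvg0_eigenvalue H l : teigenvalue H l ->
  (forall X i, (fun k => normc (iter k (tapp H) X i)) @ \oo --> (0 : R)) ->
  normc l < 1.
Proof.
move=> [X [X0 HX]] H0; have [//|l1] := ltP (normc l) 1.
have [i Xi] : exists i, X i != 0.
  apply/existsP; apply: contraNT X0 => /existsPn X0.
  by apply/eqP/ffunP => i; rewrite ffunE; apply/eqP; rewrite -[_ == _]negbK X0.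
have Xi0 : 0 < normc (X i).
  by rewrite lt_neqAle normc_ge0 andbT eq_sym; apply: contra Xi => /eqP/eq0_normc ->.
(* The tolerance is |X_i| itself, and the threshold rank [k] already yields the contradiction. *)
have /cvgrPdist_lt/(_ _ Xi0)[k _ /(_ k (leqnn _))] := H0 X i.
rewrite /= (iter_tapp_eigen _ HX) ffunE sub0r normrN (ger0_norm (normc_ge0 _)).
rewrite normcM ltNge => /negP[]; rewrite ler_peMl ?normc_ge0 //.
elim: k => [|k IH]; first by rewrite expr0 normc1.
by rewrite exprS normcM mulr_ege1.
Qed.

End Scheme.

Theorem theorem5p11 (R : realType) (N : nat) (I : 'I_N -> nat)
    (hN : (0 < N)%N) (hI : forall s : 'I_N, (0 < I s)%N)
    (A : tensor2 R I I) (hA : tnonsingular A)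
    (B : tensor R I) (H : tensor2 R I I)
    (C : tensor R I)
    (hC : C = tapp (tmul (tid I - H) (tinv A)) B) :
  (forall X0 : tensor R I, tcvg (scheme H C X0) (tapp (tinv A) B))
  <-> spectral_radius H < 1.
Proof.
(* With [L] standing for A^-1 B, associativity turns [C] into (I - H) L, expanded next to L - H
   L. *)
move: (tapp (tinv A) B) hC (tapp_tmul (tid I - H) (tinv A) B) => L -> ->.
(* The spectral radius is replaced by |l| for an eigenvalue [l] of maximal modulus, which exists
   because all dimensions are positive. *)
rewrite tapp_tidB; have [[l lH <-] l_max] := spectral_radius_max H hI.
split=> [cv|l1 X].
- apply: (cvg0_eigenvalue lH) => X i.
  (* The initial guess X + L has initial error X. *)
  by have /tcvg_scheme/(_ i) := cv (X + L); rewrite addrK.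
- apply/tcvg_scheme => i; under eq_fun do rewrite iter_tapp_mx.
  apply: cvg0_mulmx_iter => z /teigenvalueE zH.
  exact: le_lt_trans (l_max _ zH) l1.
Qed.
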